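(* Let $G$ be a finite graph with edge set $E(G)$, $F$ a field of characteristic $0$, $r_G$ the maximum size of a matching in $G$, and $1 \le \ell \le k \le r_G$. For integers $a, b \ge 0$ define the $\operatorname{Aut}(G)$-equivariant linear map $\Pi_{a,b} : V_a \otimes V_b \to F[x_e]_{e \in E(G)}$ by $x_M \otimes x_{M'} \mapsto \left(\prod_{e \in M} x_e\right)\left(\prod_{e' \in M'} x_{e'}\right)$. Let $\Phi_{\ell,k} : V_{\ell-1} \otimes V_{k+1} \to V_\ell \otimes V_k$ be the linear map defined on basis elements by \[ x_M \otimes x_{M'} \mapsto \frac{1}{p_{M,M'}} \sum_{(N,N') \in \mathbf{N}(M,M')} x_N \otimes x_{N'} .\] Then $\Pi_{\ell,k} \circ \Phi_{\ell,k} = \Pi_{\ell-1,k+1}$, i.e., the triangle formed by these $\operatorname{Aut}(G)$-equivariant maps commutes.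
   Context: A $k$-matching in $G$ is a set of $k$ pairwise vertex-disjoint edges; $\mathbf{M}_k$ is the set of $k$-matchings. $V_k$ is the $F$-vector space with basis $\{x_M : M \in \mathbf{M}_k\}$, with $\operatorname{Aut}(G)$ acting by $\sigma\cdot x_M = x_{\sigma(M)}$, diagonally on tensor products, and on the polynomial ring $F[x_e]_{e\in E(G)}$ by permuting variables, $\sigma \cdot x_e = x_{\sigma(e)}$. For $M \in \mathbf{M}_{\ell-1}$ and $M' \in \mathbf{M}_{k+1}$, let $G(M,M')$ be the subgraph of edges in exactly one of $M, M'$; call edges of $M$ blue and edges of $M'$ pink. Each component of $G(M,M')$ is a path or an even cycle with alternating colors. A pink chain is a path component with an odd number of edges whose two end edges are in $M'$; $p_{M,M'} \ge 2$ is the number of pink chains. For each pink chain $C$, swapping colors on $C$ yields the pair $(N,N')$ with $N = (M\setminus C)\cup(M'\cap C)$ (an $\ell$-matching) and $N' = (M'\setminus C)\cup(M\cap C)$ (a $k$-matching); $\mathbf{N}(M,M')$ is the set of these $p_{M,M'}$ pairs. *)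

(* Defs.v *)
From HB Require Import structures.
From mathcomp Require Import all_boot all_order all_fingroup all_algebra.
From mathcomp Require Import mpoly.

Set Implicit Arguments.
Unset Strict Implicit.
Unset Printing Implicit Defensive.

Import GRing.Theory.
Local Open Scope ring_scope.

Record sgraph := SGraph {
  vertex :> finType;
  adj : rel vertex;
  adj_sym : ssrbool.symmetric adj;
  adj_irrefl : irreflexive adj }.

Definition is_edge (G : sgraph) (A : {set G}) : bool :=
  [exists x : G, exists y : G, adj x y && (A == [set x; y])].

Definition edge (G : sgraph) := {A : {set G} | is_edge A}.
HB.instance Definition _ (G : sgraph) := Finite.on (edge G).
HB.instance Definition _ (G : sgraph) := SubType.on (edge G).

Definition Autg (G : sgraph) : {set {perm G}} :=
  [set s : {perm G} | [forall x : G, forall y : G, adj (s x) (s y) == adj x y]].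

Lemma AutgP (G : sgraph) (s : {perm G}) :
  reflect (forall x y, adj (s x) (s y) = adj x y) (s \in Autg G).
Proof.
rewrite inE; apply: (iffP forallP) => H x; last by apply/forallP=> y; rewrite H.
by move=> y; apply/eqP; move/forallP: (H x).
Qed.

Lemma Autg_group_set (G : sgraph) : group_set (Autg G).
Proof.
apply/group_setP; split; first by apply/AutgP=> x y; rewrite !perm1.
by move=> s t /AutgP Hs /AutgP Ht; apply/AutgP=> x y; rewrite !permM Ht Hs.
Qed.
Canonical Autg_group (G : sgraph) := Group (Autg_group_set G).

Definition graph_aut (G : sgraph) := subg_of (Autg_group G).

Lemma aut_edge_subproof (G : sgraph) (s : graph_aut G) (f : edge G) :
  is_edge (val s @: val f).
Proof.
case: f => A /= /existsP[x /existsP[y /andP[xy /eqP->]]].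
apply/existsP; exists (val s x); apply/existsP; exists (val s y).
by rewrite (AutgP _ (valP s)) xy imsetU !imset_set1 eqxx.
Qed.

Definition aut_edge (G : sgraph) (s : graph_aut G) (f : edge G) : edge G :=
  exist _ (val s @: val f) (aut_edge_subproof s f).

Lemma aut_edge_inj (G : sgraph) (s : graph_aut G) : injective (aut_edge s).
Proof.
by move=> f g [] /(imset_inj (@perm_inj _ (val s))) /val_inj.
Qed.

Definition is_matching (G : sgraph) (M : {set edge G}) : bool :=
  [forall f in M, forall g in M, (f != g) ==> [disjoint val f & val g]].

Definition matching_number (G : sgraph) : nat :=
  \max_(M : {set edge G} | is_matching M) #|M|.

Definition matching (G : sgraph) (k : nat) :=
  {M : {set edge G} | is_matching M && (#|M| == k)}.
HB.instance Definition _ (G : sgraph) k := Finite.on (matching G k).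
HB.instance Definition _ (G : sgraph) k := SubType.on (matching G k).

Lemma aut_matching_subproof (G : sgraph) k (s : graph_aut G) (M : matching G k) :
  is_matching (aut_edge s @: val M) && (#|aut_edge s @: val M| == k).
Proof.
case: M => M /= /andP[mM /eqP cM].
rewrite card_imset ?cM ?eqxx ?andbT; last exact: aut_edge_inj.
apply/forall_inP=> _ /imsetP[f fM ->]; apply/forall_inP=> _ /imsetP[g gM ->].
apply/implyP=> nfg; have {}nfg : f != g by apply: contraNneq nfg => ->.
have /= := implyP (forall_inP (forall_inP mM f fM) g gM) nfg.
rewrite -!setI_eq0 -imsetI; last by move=> ? ? _ _; apply: perm_inj.
by move=> /eqP->; rewrite imset0.
Qed.

Definition aut_matching (G : sgraph) k (s : graph_aut G) (M : matching G k) :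
    matching G k :=
  exist _ (aut_edge s @: val M) (aut_matching_subproof s M).

Definition symdiff (G : sgraph) (M M' : {set edge G}) : {set edge G} :=
  (M :\: M') :|: (M' :\: M).

Definition sub_adj (G : sgraph) (D : {set edge G}) : rel G :=
  fun x y => [exists f in D, val f == [set x; y]].

(* A component of the subgraph with edge set [D] is represented by its set of
   edges; such a subgraph has no isolated vertices. *)
Definition component_edges (G : sgraph) (D : {set edge G}) (x : G) :
    {set edge G} :=
  [set f in D | val f \subset [set y | connect (sub_adj D) x y]].

Definition components (G : sgraph) (D : {set edge G}) : {set {set edge G}} :=
  [set component_edges D x | x in cover [set val f | f in D]].

Definition path_edges (T : finType) (s : seq T) : seq {set T} :=
  if s is x :: p then pairmap (fun u v => [set u; v]) x p else [::].

(* The vertices of a path are distinct, so a path has [n < #|G|] edges and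
   [n.+1] vertices. *)
Definition pink_chain (G : sgraph) (M M' C : {set edge G}) : bool :=
  [&& C \in components (symdiff M M'), odd #|C| &
      [exists n : 'I_#|G|, exists t : n.+1.-tuple G,
        [&& uniq t,
            [set val f | f in C] == [set A in path_edges t],
            head set0 (path_edges t) \in [set val f | f in M'] &
            last set0 (path_edges t) \in [set val f | f in M']]]].

Definition pink_chains (G : sgraph) (M M' : {set edge G}) :
    {set {set edge G}} := [set C | pink_chain M M' C].

Definition num_pink_chains (G : sgraph) (M M' : {set edge G}) : nat :=
  #|pink_chains M M'|.

Definition swaps (G : sgraph) (l k : nat) (M M' : {set edge G}) :
    {set matching G l * matching G k} :=
  [set P | [exists C in pink_chains M M',
     (val P.1 == (M :\: C) :|: (M' :&: C)) &&
     (val P.2 == (M' :\: C) :|: (M :&: C))]].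

Definition freevs (F : fieldType) (I : finType) := {ffun I -> F^o}.
HB.instance Definition _ F I := GRing.Lmodule.on (freevs F I).

Definition bvec (F : fieldType) (I : finType) (i : I) : freevs F I :=
  [ffun j => (j == i)%:R].

Section LinearExtension.
Variables (F : fieldType) (I : finType) (V : lmodType F) (f : I -> V).

Definition linext (u : freevs F I) : V := \sum_i (u i : F) *: f i.

Lemma linext_is_linear : linear linext.
Proof.
move=> a u v; rewrite /linext scaler_sumr -big_split; apply: eq_bigr => i _ /=.
by rewrite !ffunE scalerDl scalerA.
Qed.
HB.instance Definition _ :=
  GRing.isLinear.Build F (freevs F I) V _ linext linext_is_linear.

Lemma linext_bvec i : linext (bvec F i) = f i.
Proof.
rewrite /linext (bigD1 i) //= big1 ?addr0 => [|j ji]; rewrite ffunE.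
  by rewrite eqxx scale1r.
by rewrite (negPf ji) scale0r.
Qed.

End LinearExtension.

Definition Vsp (F : fieldType) (G : sgraph) (k : nat) :=
  freevs F (matching G k).
HB.instance Definition _ F G k := GRing.Lmodule.on (Vsp F G k).

(* The tensor product is the space with basis the pairs of basis elements;
   [tens] is its universal bilinear map. *)
Definition VV (F : fieldType) (G : sgraph) (a b : nat) :=
  freevs F (matching G a * matching G b)%type.
HB.instance Definition _ F G a b := GRing.Lmodule.on (VV F G a b).

Definition tens (F : fieldType) (G : sgraph) (a b : nat)
    (u : Vsp F G a) (v : Vsp F G b) : VV F G a b :=
  [ffun P => (u P.1 : F) * (v P.2 : F)].

Lemma tens_bvec F G a b (M : matching G a) (M' : matching G b) :
  tens (bvec F M) (bvec F M') = bvec F (M, M').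
Proof. by apply/ffunP=> -[N N']; rewrite !ffunE /= -mulnb natrM. Qed.

Definition actV (F : fieldType) (G : sgraph) (k : nat) (s : graph_aut G) :
    {linear Vsp F G k -> Vsp F G k} :=
  linext (fun M => bvec F (aut_matching s M)).

Definition actVV (F : fieldType) (G : sgraph) (a b : nat) (s : graph_aut G) :
    {linear VV F G a b -> VV F G a b} :=
  linext (fun P => tens (actV F a s (bvec F P.1)) (actV F b s (bvec F P.2))).

Lemma actVV_tens F G a b s (u : Vsp F G a) (v : Vsp F G b) :
  actVV F a b s (tens u v) = tens (actV F a s u) (actV F b s v).
Proof.
apply/ffunP=> -[N N']; rewrite /= !ffunE !sum_ffunE /= mulr_suml.
under [RHS]eq_bigr do rewrite mulr_sumr.
rewrite pair_big; apply: eq_bigr => -[M M'] _ /=.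
by rewrite !linext_bvec !ffunE /= /GRing.scale /= mulrACA.
Qed.

(* The polynomial ring in the variables [x_e]; [enum_rank] numbers the edges. *)

Notation polyE F G := {mpoly F[#|{: edge G}|]}.

Definition xvar (F : fieldType) (G : sgraph) (f : edge G) : polyE F G :=
  'X_(enum_rank f).

Definition act_poly (F : fieldType) (G : sgraph) (s : graph_aut G) (p : polyE F G) :
    polyE F G :=
  p \mPo [tuple xvar F (aut_edge s (enum_val i)) | i < #|{: edge G}|].

Definition Pi (F : fieldType) (G : sgraph) (a b : nat) :
    {linear VV F G a b -> polyE F G} :=
  linext (fun P : matching G a * matching G b =>
    (\prod_(f in val P.1) xvar F f) * (\prod_(f in val P.2) xvar F f)).

Definition Phi (F : fieldType) (G : sgraph) (l k : nat) :
    {linear VV F G l.-1 k.+1 -> VV F G l k} :=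
  linext (fun P : matching G l.-1 * matching G k.+1 =>
    (num_pink_chains (val P.1) (val P.2))%:R^-1 *:
      \sum_(Q in swaps l k (val P.1) (val P.2)) tens (bvec F Q.1) (bvec F Q.2)).

(* Main.v *)
(** Swapping the colours on a pink chain permutes the edges of the multiset
    union of [M] and [M'], so every pair in [N(M,M')] is sent by [Pi] to the
    monomial of [(M, M')]; it remains to see that there are [p_{M,M'} > 0]
    such pairs.  Colours alternate along a path of the symmetric difference,
    hence a component [C] is a pink chain exactly when it has more edges in
    [M'] than in [M], and then the excess is one: if [C] is heavier in [M'],
    the vertices covered by [M'] in [C] outnumber those covered by [M], so some
    vertex of [C] lies on no edge of [M] in [C], and a longest path from it is
    all of [C].  As [|M| < |M'|], some component is heavier in [M'].  This
    counting description of pink chains is visibly invariant under graph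
    automorphisms, which gives the equivariance of [Phi]. *)

Require Import Defs.
From mathcomp Require Import all_boot all_order all_fingroup all_algebra.
From mathcomp Require Import mpoly zify.

Set Implicit Arguments.
Unset Strict Implicit.
Unset Printing Implicit Defensive.

Import GRing.Theory.
Local Open Scope ring_scope.

(** * Linear maps out of a free space are determined by the basis vectors *)

Section LinearMaps.

Variables (F : fieldType) (I : finType).

Lemma freevs_sum_bvec (u : freevs F I) : u = \sum_i (u i : F) *: bvec F i.
Proof.
apply/ffunP=> j; rewrite sum_ffunE (bigD1 j) //= big1 => [|i ij].
  by rewrite !ffunE eqxx addr0 /GRing.scale /= mulr1.
by rewrite !ffunE eq_sym (negPf ij) /GRing.scale /= mulr0.
Qed.

Lemma eq_linear_bvec (V : lmodType F) (f g : {linear freevs F I -> V}) :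
  (forall i, f (bvec F i) = g (bvec F i)) -> f =1 g.
Proof.
move=> fg u; rewrite [u]freevs_sum_bvec !linear_sum.
by apply: eq_bigr => i _; rewrite !linearZ /= fg.
Qed.

End LinearMaps.

(** * Alternating sequences and the edge list of a vertex path *)

Section Alternation.

Local Open Scope nat_scope.

(** Neighbouring entries pair off, so the two classes differ only through the first and last
    entries. The end corrections sit on both sides to avoid subtraction in [nat]. *)
Lemma alternating_count (T : Type) (c : pred T) x p :
    path (fun a b => c a != c b) x p ->
  count c (x :: p) + ~~ c x = count (predC c) (x :: p) + c (last x p).
Proof.
elim: p x => [|y p IH] x /=; first by case: (c x).
case/andP=> cxy /IH /=; move: cxy.
by case: (c x); case: (c y); case: (c (last y p)) => //= _; lia.
Qed.

Variable T : finType.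

Lemma mem_path_edges_sub (x : T) p (A : {set T}) :
  A \in path_edges (x :: p) -> {subset A <= x :: p}.
Proof.
elim: p x => [|y p IH] x //=; rewrite inE => /orP[/eqP->|/IH sA] z.
  by rewrite !inE => /orP[]/eqP->; rewrite eqxx ?orbT.
by move/sA=> zp; rewrite inE zp orbT.
Qed.

Lemma mem_path_edges_cat (x z : T) p q :
  [set last x p; z] \in path_edges (x :: p ++ z :: q).
Proof. by elim: p x => [|y p IH] x /=; rewrite inE ?eqxx // IH orbT. Qed.

(** The first edge contains the first vertex, which occurs in no later edge. *)
Lemma path_edges_uniq (s : seq T) : uniq s -> uniq (path_edges s).
Proof.
case: s => // x p; elim: p x => [|y p IH] x //= /andP[xyp uyp].
rewrite (IH y) // andbT; apply/negP=> /mem_path_edges_sub /(_ x).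
by rewrite set21 (negPf xyp) => /(_ isT).
Qed.

End Alternation.

(** * Edges, matchings and the vertices they cover *)

Section Matchings.

Variable G : sgraph.
Implicit Types (M C D X : {set edge G}) (f g : edge G) (x y z : G).

Lemma edgeP f z :
  z \in val f -> exists2 y, y != z & val f = [set z; y].
Proof.
case: f => A /= /existsP[a /existsP[b /andP[ab /eqP->]]].
have nab : a != b by apply: contraTneq ab => ->; rewrite adj_irrefl.
rewrite !inE => /orP[]/eqP->; first by exists b => //; rewrite eq_sym.
by exists a => //; rewrite setUC.
Qed.

Lemma edge_inhabited f : exists z, z \in val f.
Proof.
case: f => A /= /existsP[a /existsP[b /andP[ab /eqP->]]].
by exists a; rewrite set21.
Qed.

Lemma card_edge f : #|val f| = 2%N.
Proof.
have [z /edgeP[y yz ->]] := edge_inhabited f.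
by rewrite cards2 eq_sym yz.
Qed.

Lemma matching_eq M f g z :
  is_matching M -> f \in M -> g \in M -> z \in val f -> z \in val g -> f = g.
Proof.
move=> mM fM gM zf zg; apply/eqP; apply: contraT => nfg.
have := implyP (forall_inP (forall_inP mM f fM) g gM) nfg.
by move/disjoint_setI0/setP/(_ z); rewrite !inE zf zg.
Qed.

Lemma is_matchingP M :
  reflect (forall f g z, f \in M -> g \in M -> z \in val f -> z \in val g ->
             f = g)
    (is_matching M).
Proof.
apply: (iffP idP) => [mM f g z|H]; first exact: matching_eq.
apply/forall_inP=> f fM; apply/forall_inP=> g gM; apply/implyP=> nfg.
rewrite -setI_eq0; apply/set0Pn=> -[z /setIP[zf zg]].
by rewrite (H f g z) ?eqxx in nfg.
Qed.

Lemma matching_sub M M' : M' \subset M -> is_matching M -> is_matching M'.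
Proof.
move=> /subsetP sM /is_matchingP mM; apply/is_matchingP=> f g z /sM fM /sM gM.
exact: mM.
Qed.

(** Distinct edges of a matching are disjoint and have two vertices each. This turns a comparison of
    edge counts into one of covered vertices. *)
Lemma card_cover_matching M :
  is_matching M -> #|cover [set val f | f in M]| = (#|M| * 2)%N.
Proof.
move=> mM; have /eqP <- : trivIset [set val f | f in M].
  apply/trivIsetP=> _ _ /imsetP[f fM ->] /imsetP[g gM ->] nfg.
  rewrite -setI_eq0; apply/set0Pn=> -[z /setIP[zf zg]].
  by rewrite (matching_eq mM fM gM zf zg) eqxx in nfg.
rewrite big_imset /=; last by move=> f g _ _ /val_inj.
by rewrite (eq_bigr _ (fun f _ => card_edge f)) sum_nat_const.
Qed.

(** * Components as classes of edges *)

Section Components.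

Variable D : {set edge G}.

Lemma sub_adjP x y :
  reflect (exists2 f, f \in D & val f = [set x; y]) (sub_adj D x y).
Proof.
apply: (iffP existsP) => [[f /andP[fD /eqP e]]|[f fD e]]; exists f => //.
by rewrite fD e eqxx.
Qed.

Lemma sub_adj_sym : ssrbool.symmetric (sub_adj D).
Proof. by move=> x y; apply/sub_adjP/sub_adjP=> -[f fD e]; exists f; rewrite // setUC. Qed.

Lemma connect_edge f x y :
  f \in D -> x \in val f -> y \in val f -> connect (sub_adj D) x y.
Proof.
move=> fD /edgeP[z _ e]; rewrite e !inE => /orP[]/eqP-> //.
by apply/connect1/sub_adjP; exists f.
Qed.

(** Either endpoint decides membership, because the edge itself connects it to the other one. *)
Lemma mem_component_edges f x z :
  f \in D -> z \in val f ->
  (f \in component_edges D x) = connect (sub_adj D) x z.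
Proof.
move=> fD zf; rewrite inE fD /=; apply/subsetP/idP => [/(_ z zf)|xz y yf].
  by rewrite inE.
by rewrite inE (connect_trans xz) // (connect_edge fD).
Qed.

Lemma component_edges_connect x y :
  connect (sub_adj D) x y -> component_edges D x = component_edges D y.
Proof.
move=> xy; apply/setP=> f; case: (boolP (f \in D)) => [fD|/negPf nD].
  have [z zf] := edge_inhabited f; rewrite !(mem_component_edges _ fD zf).
  exact: same_connect (sym_connect_sym sub_adj_sym) _ _ xy z.
by rewrite !inE nD.
Qed.

Lemma componentsP C :
  reflect (exists f x, [/\ f \in D, x \in val f & C = component_edges D x])
    (C \in components D).
Proof.
apply: (iffP imsetP) => [[x /bigcupP[_ /imsetP[f fD ->] xf] ->]|].
  by exists f, x.
case=> f [x [fD xf ->]]; exists x => //; apply/bigcupP; exists (val f) => //.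
exact: imset_f.
Qed.

Lemma component_sub C : C \in components D -> C \subset D.
Proof. by case/componentsP=> f [x [_ _ ->]]; apply/subsetP=> g /setIdP[]. Qed.

Lemma component_of C f z :
  C \in components D -> f \in C -> z \in val f -> C = component_edges D z.
Proof.
move=> CD fC zf; have fD := subsetP (component_sub CD) f fC.
case/componentsP: CD fC => g [x [_ _ ->]]; rewrite (mem_component_edges _ _ zf) //.
exact: component_edges_connect.
Qed.

Lemma component_closed C f g z :
    C \in components D -> f \in C -> g \in D -> z \in val f -> z \in val g ->
  g \in C.
Proof.
move=> CD fC gD zf zg; rewrite (component_of CD fC zf).
by rewrite (mem_component_edges _ _ zg).
Qed.

Lemma partition_components : partition (components D) D.
Proof.
apply/and3P; split.
- rewrite eqEsubset; apply/andP; split; apply/subsetP=> f.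
    by case/bigcupP=> C CD fC; rewrite (subsetP (component_sub CD)).
  move=> fD; have [z zf] := edge_inhabited f.
  apply/bigcupP; exists (component_edges D z).
    by apply/componentsP; exists f, z.
  by rewrite (mem_component_edges _ _ zf).
- apply/trivIsetP=> A B AD BD; apply: contraNT; rewrite -setI_eq0.
  case/set0Pn=> f /setIP[fA fB]; have [z zf] := edge_inhabited f.
  by rewrite (component_of AD fA zf) -(component_of BD fB zf).
- apply/negP=> /componentsP[f [x [fD xf /setP/(_ f)]]].
  by rewrite (mem_component_edges _ _ xf) // connect0 inE.
Qed.

End Components.

Lemma card_component D X :
  X \subset D -> #|X| = (\sum_(C in components D) #|X :&: C|)%N.
Proof.
move=> XD; transitivity (\sum_(f in D) (f \in X : nat))%N.
  rewrite -sum1_card big_mkcond [RHS]big_mkcond; apply: eq_bigr => f _.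
  by case: ifP => [/(subsetP XD) ->|_] //; case: ifP.
rewrite (set_partition_big _ (partition_components D)); apply: eq_bigr => C _.
rewrite -sum1_card big_mkcond [RHS]big_mkcond; apply: eq_bigr => f _.
by rewrite inE; case: (f \in C); case: (f \in X).
Qed.

(** * Alternation of colours in the symmetric difference of two matchings *)

Section Pair.

Variables M M' : {set edge G}.
Hypotheses (mM : is_matching M) (mM' : is_matching M').
Local Notation D := (symdiff M M').

(** In the symmetric difference, edges of equal colour belong to one and the same matching, so they
    cannot share a vertex. *)
Lemma symdiff_alternate f g z :
    f \in D -> g \in D -> z \in val f -> z \in val g -> f != g ->
  (f \in M') != (g \in M').
Proof.
move=> fD gD zf zg; apply: contra_neq; move: fD gD; rewrite !inE.
case fM': (f \in M'); case gM': (g \in M'); rewrite ?andbT ?andbF ?orbF //=.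
  by move=> _ _ _; apply: (matching_eq mM' _ _ zf).
by move=> fM gM _; apply: (matching_eq mM _ _ zf).
Qed.

Lemma path_edges_alternate x p :
    uniq (x :: p) -> {subset path_edges (x :: p) <= [set val f | f in D]} ->
  sorted (fun A B => (A \in [set val f | f in M']) != (B \in [set val f | f in M']))
    (path_edges (x :: p)).
Proof.
elim: p x => [|y [|z p] IH] x //= /andP[xyp uyp] sD.
apply/andP; split; last by apply: IH => // A Ap; apply: sD; rewrite inE Ap orbT.
have /imsetP[f fD ef] := sD _ (mem_head _ _).
have /imsetP[g gD eg] : [set y; z] \in [set val f | f in D].
  by apply: sD; rewrite !inE eqxx orbT.
rewrite ef eg !(mem_imset _ _ val_inj).
apply: (symdiff_alternate (z := y)) => //; first by rewrite /= -ef set22.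
  by rewrite /= -eg set21.
(* If the two consecutive edges coincided, [x] would be [y] or [z], and the path would repeat a
   vertex. *)
apply: contraNneq xyp => fg; move: (set21 x y); rewrite ef fg -eg !inE.
by rewrite orbA => ->.
Qed.

Lemma card_path_component C (X : {pred edge G}) (c : pred {set G}) s :
    uniq s -> [set val f | f in C] = [set A in path_edges s] ->
    (forall f, f \in C -> c (val f) = (f \in X)) ->
  #|[set f in C | f \in X]| = count c (path_edges s).
Proof.
move=> us eC cX; rewrite -(card_imset _ val_inj) -size_filter.
have /card_uniqP <- := filter_uniq c (path_edges_uniq us).
apply: eq_card => A; rewrite mem_filter.
apply/imsetP/andP=> [[f /setIdP[fC fX] ->]|[cA As]].
  by rewrite cX // fX; split=> //; have := imset_f val fC; rewrite eC inE.
have : A \in [set val f | f in C] by rewrite eC inE.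
by case/imsetP=> f fC e; exists f; rewrite // inE fC -cX // -e.
Qed.

(** This is [alternating_count] for the class of pink edges: inside the symmetric difference, an
    edge outside [M'] is blue. Only the colours of the two end edges separate the counts. *)
Lemma path_component_balance C x p :
    C \subset D -> uniq (x :: p) -> p != [::] ->
    [set val f | f in C] = [set A in path_edges (x :: p)] ->
  (#|M' :&: C| + (head set0 (path_edges (x :: p)) \notin [set val f | f in M'])
  = #|M :&: C| + (last set0 (path_edges (x :: p)) \in [set val f | f in M']))%N.
Proof.
move=> CD us np eC; pose c A := A \in [set val f | f in M'].
have cM' f : f \in C -> c (val f) = (f \in M').
  by move=> _; rewrite /c (mem_imset _ _ val_inj).
have cM f : f \in C -> predC c (val f) = (f \in M).
  move=> fC /=; rewrite cM' //; move/(subsetP CD): fC; rewrite !inE.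
  by case: (f \in M); case: (f \in M').
have := path_edges_alternate us.
have := card_path_component us eC cM'.
have := card_path_component us eC cM.
have -> : [set f in C | f \in M] = M :&: C by apply/setP=> f; rewrite !inE andbC.
have -> : [set f in C | f \in M'] = M' :&: C by apply/setP=> f; rewrite !inE andbC.
move=> -> -> /(_ _)/wrap[].
  move=> A Ap; have : A \in [set val f | f in C] by rewrite eC inE.
  by case/imsetP=> f /(subsetP CD) fD ->; apply: imset_f.
by case: p np {us eC} => // y p _ /=; apply: alternating_count.
Qed.

End Pair.
End Matchings.

(** * Pink chains are the components heavier in [M'] *)

Section PinkChains.

Variables (G : sgraph) (M M' : {set edge G}).
Hypotheses (mM : is_matching M) (mM' : is_matching M').
Implicit Types (C : {set edge G}) (f g : edge G) (x y z : G).
Local Notation D := (symdiff M M').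

(** Three distinct edges at one vertex would need three pairwise different colours, and there are
    two. *)
Lemma symdiff_degree f g h z :
    f \in D -> g \in D -> h \in D -> z \in val f -> z \in val g ->
    z \in val h -> g != h -> f = g \/ f = h.
Proof.
move=> fD gD hD zf zg zh gh.
have [|nfg] := eqVneq f g; first by left.
have [|nfh] := eqVneq f h; first by right.
have := symdiff_alternate mM mM' fD gD zf zg nfg.
have := symdiff_alternate mM mM' fD hD zf zh nfh.
have := symdiff_alternate mM mM' gD hD zg zh gh.
by case: (f \in M'); case: (g \in M'); case: (h \in M').
Qed.

Lemma longest_path x :
  exists2 p, uniq (x :: p) && path (sub_adj D) x p &
    forall q, uniq (x :: q) -> path (sub_adj D) x q -> (size q <= size p)%N.
Proof.
pose P n := [exists t : n.-tuple G, uniq (x :: t) && path (sub_adj D) x t].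
have exP : exists n, P n by exists 0%N; apply/existsP; exists [tuple].
have Pq q : uniq (x :: q) -> path (sub_adj D) x q -> P (size q).
  by move=> uq pq; apply/existsP; exists (in_tuple q); rewrite uq pq.
have ubP n : P n -> (n <= #|G|)%N.
  case/existsP=> t /andP[/andP[_ /card_uniqP ut] _].
  by rewrite -(size_tuple t) -ut max_card.
case: (ex_maxnP exP ubP) => n /existsP[t tP] nmax; exists t => // q uq pq.
by rewrite size_tuple nmax ?Pq.
Qed.

(* A longest path starting at an end of a component that meets no edge of [M]
   exhausts that component. *)
Section FromEndpoint.

Variables (x : G) (p : seq G) (e : edge G).
Hypotheses (eD : e \in D) (xe : x \in val e).
Hypothesis xend : forall f, f \in D -> x \in val f -> f \in M'.
Hypotheses (up : uniq (x :: p)) (pp : path (sub_adj D) x p).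
Hypothesis pmax :
  forall q, uniq (x :: q) -> path (sub_adj D) x q -> (size q <= size p)%N.

Lemma longest_path_nonempty : p != [::].
Proof.
have [y yx ey] := edgeP xe; apply/eqP=> p0.
suff : (size [:: y] <= size p)%N by rewrite p0.
apply: pmax => /=; first by rewrite inE eq_sym yx.
by rewrite andbT; apply/sub_adjP; exists e.
Qed.

(** The path already uses all edges available at each vertex before its last: one at [x], where
    every edge is pink, and two at an inner vertex, where the degree is at most two. *)
Lemma incident_inner f z :
    f \in D -> z \in val f -> z \in belast x p ->
  val f \in path_edges (x :: p).
Proof.
move=> fD zf; have := longest_path_nonempty.
case/lastP: p up pp => // q w uq pq _; rewrite belast_rcons inE => /orP[/eqP zx|].
  case: (rcons q w) (size_rcons q w) pq => //= y r _ /andP[/sub_adjP[g gD eg] _].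
  rewrite zx in zf; have xg : x \in val g by rewrite eg set21.
  by rewrite (matching_eq mM' (xend fD zf) (xend gD xg) zf xg) eg mem_head.
move=> zq; case/splitPr: zq uq pq => q1 q2; rewrite rcons_cat rcons_cons.
case E : (rcons q2 w) => [|y r]; first by case: (q2) E.
move=> uq; rewrite cat_path /= => /and4P[_ /sub_adjP[g gD eg] /sub_adjP[h hD eh] _].
(* The path edges entering and leaving [z] differ, since otherwise the predecessor of [z] would
   reappear as [z] or as its successor [y]. *)
have gh : g != h.
  apply: contraTneq uq => gh; have : last x q1 \in val g by rewrite eg set21.
  rewrite gh eh -cat_cons cat_uniq => le; apply/negP=> /and3P[_ /hasPn H _].
  have : last x q1 \in [:: z, y & r].
    by move: le; rewrite !inE => /orP[]/eqP->; rewrite eqxx ?orbT.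
  by move/H; rewrite mem_last.
have [||->|->] := symdiff_degree fD gD hD zf _ _ gh.
- by rewrite eg set22.
- by rewrite eh set21.
- by rewrite eg mem_path_edges_cat.
- by rewrite eh -cat_rcons -{1}(last_rcons x q1 z) mem_path_edges_cat.
Qed.

(** At the last vertex, the other end of [f] either lies earlier on the path, where [incident_inner]
    applies, or prolongs the path against maximality. *)
Lemma incident_path f z :
  f \in D -> z \in val f -> z \in x :: p -> val f \in path_edges (x :: p).
Proof.
have mem_xp y : (y \in x :: p) = (y \in rcons (belast x p) (last x p)) by rewrite -lastI.
move=> fD zf; rewrite mem_xp mem_rcons inE => /orP[/eqP zl|]; last exact: incident_inner.
have [y yz ef] := edgeP zf.
have yf : y \in val f by rewrite ef set22.
have [|nyp] := boolP (y \in x :: p).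
  by rewrite mem_xp mem_rcons inE -zl (negPf yz) /=; apply: incident_inner.
suff : (size (rcons p y) <= size p)%N by rewrite size_rcons ltnn.
apply: pmax; first by rewrite -rcons_cons rcons_uniq nyp.
by rewrite rcons_path pp -zl; apply/sub_adjP; exists f.
Qed.

Lemma component_longest_path :
  [set val f | f in component_edges D x] = [set A in path_edges (x :: p)].
Proof.
(* The vertices of the path are closed under adjacency, so they contain everything connected to
   [x]. *)
have closedp y z : sub_adj D y z -> y \in x :: p -> z \in x :: p.
  case/sub_adjP=> f fD ef yp.
  have /mem_path_edges_sub : val f \in path_edges (x :: p).
    by apply: (incident_path fD _ yp); rewrite ef set21.
  by apply; rewrite ef set22.
have conn y : connect (sub_adj D) x y -> y \in x :: p.
  case/connectP=> q; elim/last_ind: q y => [|q z IH] y; first by move=> _ ->; apply: mem_head.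
  rewrite rcons_path last_rcons => /andP[pq zq] ->; exact: closedp zq (IH _ pq erefl).
apply/setP=> A; rewrite inE; apply/imsetP/idP => [[f fC ->]|].
  have [z zf] := edge_inhabited f; have /setIdP[fD _] := fC.
  by apply: (incident_path fD zf); apply: conn; rewrite -(mem_component_edges _ fD zf).
have sub : {subset path_edges (x :: p) <= [set val f | f in D]}.
  elim: (p) x pp => [|y q IH] z //= /andP[/sub_adjP[f fD ef] pq] B.
  by rewrite inE => /orP[/eqP->|/(IH _ pq)] //; rewrite -ef; apply: imset_f.
move=> Ap; have /imsetP[f fD ef] := sub _ Ap; exists f => //.
have [z zf] := edge_inhabited f; rewrite (mem_component_edges _ fD zf).
by apply: (path_connect pp); apply: (mem_path_edges_sub Ap); rewrite ef.
Qed.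
End FromEndpoint.

(** With both end edges pink, the balance formula leaves an excess of exactly one. *)
Lemma pink_chain_card C : pink_chain M M' C -> #|M' :&: C| = #|M :&: C|.+1.
Proof.
case/and3P=> /component_sub CD oC /existsP[n /existsP[[[|x p] /= st]]] //=.
case/and4P=> ut /eqP eC hd la.
(* A one-vertex path has no edges, which would make [#|C|] zero instead of odd. *)
have np : p != [::].
  apply: contraTneq oC => p0; move: eC; rewrite p0 => eC.
  rewrite -(card_imset _ val_inj) eC (eq_card0 (A := [set _ in _])) // => A.
  by rewrite inE.
have := path_component_balance mM mM' CD ut np eC.
by rewrite hd la addn0 addn1.
Qed.

Lemma pink_chain_heavy C :
  C \in components D -> (#|M :&: C| < #|M' :&: C|)%N -> pink_chain M M' C.
Proof.
move=> CD ltC; have sCD := component_sub CD.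
(* The pink edges of [C] cover more vertices than the blue ones, which yields a vertex [x] on a pink
   edge of [C] and on no blue edge of [C]. *)
have /subsetPn[x] :
    ~~ (cover [set val f | f in M' :&: C] \subset cover [set val f | f in M :&: C]).
  apply: contraL ltC => /subset_leq_card.
  rewrite !card_cover_matching ?leq_mul2r -?leqNgt //.
    exact: matching_sub (subsetIl _ _) mM.
  exact: matching_sub (subsetIl _ _) mM'.
case/bigcupP=> _ /imsetP[e /setIP[eM' eC] ->] xe nxM.
have eD := subsetP sCD e eC.
have eCx := component_of CD eC xe.
(* A blue edge of [D] at [x] would belong to [C], against the choice of [x]. *)
have xend f : f \in D -> x \in val f -> f \in M'.
  move=> fD xf; move: (fD); rewrite !inE => /orP[/andP[_ fM]|/andP[] //].
  case/bigcupP: nxM; exists (val f) => //; apply: imset_f.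
  by rewrite inE fM (component_closed CD eC fD xe xf).
have [p /andP[up pp] pmax] := longest_path x.
have np := longest_path_nonempty eD xe pmax.
have eCp := component_longest_path eD xe xend up pp pmax; rewrite -eCx in eCp.
have bal := path_component_balance mM mM' sCD up np eCp.
have hd : head set0 (path_edges (x :: p)) \in [set val f | f in M'].
  have : head set0 (path_edges (x :: p)) \in [set A in path_edges (x :: p)].
    by case: (p) np => // y q _; rewrite inE mem_head.
  have xh : x \in head set0 (path_edges (x :: p)) by case: (p) np => //= y q _; rewrite set21.
  rewrite -eCp => /imsetP[f fC ef]; rewrite ef imset_f // xend ?(subsetP sCD) //.
  by rewrite /= -ef.
rewrite hd addn0 in bal.
(* With the first edge pink, a blue last edge would balance the two colours, contradicting [ltC]. *)
have la : last set0 (path_edges (x :: p)) \in [set val f | f in M'].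
  by move: ltC; rewrite bal; case: (last _ _ \in _); rewrite // addn0 ltnn.
rewrite la in bal.
apply/and3P; split=> //.
  (* [C] splits into its blue and pink edges; with an excess of one, its size is odd. *)
  have -> : #|C| = (#|M :&: C| + #|M' :&: C|)%N.
    rewrite -cardsUI -[LHS]addn0; congr (_ + _)%N; last first.
      apply/esym/eqP; rewrite cards_eq0; apply/eqP/setP=> f; rewrite !inE.
      case fC: (f \in C); rewrite ?andbF //.
      by have := subsetP sCD f fC; rewrite !inE; case: (f \in M); case: (f \in M').
    apply: eq_card => f; rewrite !inE; case fC: (f \in C); rewrite ?andbF //.
    by have := subsetP sCD f fC; rewrite !inE; case: (f \in M); case: (f \in M').
  by rewrite bal addnA oddD addnn odd_double.
have szp : (size p < #|G|)%N by have := max_card (mem (x :: p)); rewrite (card_uniqP up).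
apply/existsP; exists (Ordinal szp); apply/existsP; exists (in_tuple (x :: p)).
by apply/and4P; split=> //; apply/eqP.
Qed.

Lemma pink_chainE C :
  pink_chain M M' C = (C \in components D) && (#|M :&: C| < #|M' :&: C|)%N.
Proof.
apply/idP/andP=> [pC|[CD]]; last exact: pink_chain_heavy.
by rewrite (pink_chain_card pC); case/and3P: pC.
Qed.

Lemma num_pink_chains_gt0 : (#|M| < #|M'|)%N -> (0 < num_pink_chains M M')%N.
Proof.
(* Removing the common edges lowers both cardinals equally. *)
move=> ltM; have ltD : (#|M :\: M'| < #|M' :\: M|)%N.
  have := cardsID M' M; have := cardsID M M'; rewrite setIC; lia.
have /existsP[C /andP[CD ltC]] :
    [exists C, (C \in components D) && (#|M :&: C| < #|M' :&: C|)%N].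
  (* If no component were heavier in [M'], summing over the components would contradict [ltD]. *)
  apply: contraLR ltD; rewrite negb_exists -leqNgt => /forallP H.
  rewrite (card_component (D := D) (subsetUr _ _)).
  rewrite (card_component (D := D) (subsetUl _ _)); apply: leq_sum => C CD.
  have sCD := subsetP (component_sub CD).
  have := H C; rewrite CD -leqNgt /=; congr (_ <= _)%N; apply: eq_card => f;
    rewrite !inE; case fC: (f \in C); rewrite ?andbF // ?andbT;
    by have := sCD f fC; rewrite !inE; case: (f \in M); case: (f \in M').
by apply/card_gt0P; exists C; rewrite inE pink_chainE CD.
Qed.

End PinkChains.

(** * Swapping colours on a component *)

Section Swap.

Variable G : sgraph.

(** This is $N$; exchanging the two matchings, [swap M' M C] is $N'$. *)
Definition swap (M M' C : {set edge G}) := (M :\: C) :|: (M' :&: C).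

Section PinkSwap.

Variables M M' C : {set edge G}.
Hypotheses (mM : is_matching M) (mM' : is_matching M').
Hypothesis CD : C \in components (symdiff M M').

Lemma swap_matching : is_matching (swap M M' C).
Proof.
(* The only delicate pair has a kept edge of [M] and an imported edge of [M']. If the kept edge is
   also in [M'], that matching settles it; otherwise it lies in the symmetric difference and touches
   [C], hence belongs to [C]. *)
have cross f g z : f \in M -> f \notin C -> g \in M' -> g \in C ->
    z \in val f -> z \in val g -> f = g.
  move=> fM fC gM' gC zf zg.
  have [fM'|fM'] := boolP (f \in M'); first exact: (matching_eq mM' _ _ zf).
  have fD : f \in symdiff M M' by rewrite !inE fM fM'.
  by rewrite (component_closed CD gC fD zg zf) in fC.
apply/is_matchingP=> f g z; rewrite !inE.
move=> fN gN zf zg; move: fN gN.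
case: (boolP (f \in C)) => fC; case: (boolP (g \in C)) => gC;
  rewrite ?andbF ?andbT ?orbF /= => fM gM.
- by apply: (matching_eq mM' _ _ zf).
- by apply/esym; apply: (cross g f z).
- by apply: (cross f g z).
- by apply: (matching_eq mM _ _ zf).
Qed.

(** The chain can be read off from the swapped matching, so distinct chains give distinct pairs. *)
Lemma symdiff_swap : symdiff M (swap M M' C) = C.
Proof.
apply/setP=> f; rewrite !inE; case fC: (f \in C).
  have := subsetP (component_sub CD) f fC; rewrite !inE.
  by case: (f \in M); case: (f \in M').
by rewrite andbF orbF; case: (f \in M).
Qed.

End PinkSwap.

Variables M M' : {set edge G}.

Lemma symdiffC : symdiff M M' = symdiff M' M.
Proof. by rewrite /symdiff setUC. Qed.

Variable C : {set edge G}.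

Lemma swapI : swap M M' C :&: C = M' :&: C.
Proof. by apply/setP=> f; rewrite !inE; case: (f \in C); rewrite /= ?andbF ?andbT. Qed.

Lemma swapD : swap M M' C :\: C = M :\: C.
Proof. by apply/setP=> f; rewrite !inE; case: (f \in C); rewrite /= ?andbF ?orbF. Qed.

Lemma card_swap : (#|swap M M' C| + #|M :&: C| = #|M| + #|M' :&: C|)%N.
Proof. by rewrite -(cardsID C (swap _ _ _)) -(cardsID C M) swapI swapD; lia. Qed.

End Swap.

(** Splitting every product along [C], the swap merely exchanges the factors over [M :&: C] and
    [M' :&: C]. *)
Lemma prod_swap (G : sgraph) (R : comNzRingType) (h : edge G -> R)
    (M M' C : {set edge G}) :
  (\prod_(f in swap M M' C) h f) * (\prod_(f in swap M' M C) h f)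
  = (\prod_(f in M) h f) * (\prod_(f in M') h f).
Proof.
rewrite (big_setID C) [X in _ * X](big_setID C) /= !swapI !swapD.
rewrite [X in _ = X * _](big_setID C) [X in _ = _ * X](big_setID C) /=.
by rewrite mulrACA [X in X * _]mulrC mulrACA.
Qed.

(** * Pink chains correspond bijectively to swapped pairs *)

Section Swaps.

Variables (G : sgraph) (l k : nat) (M M' : {set edge G}).
Hypotheses (mM : is_matching M) (mM' : is_matching M').

Lemma swapsP (Q : matching G l * matching G k) :
  reflect (exists C, [/\ pink_chain M M' C, val Q.1 = swap M M' C
                        & val Q.2 = swap M' M C])
    (Q \in swaps l k M M').
Proof.
rewrite inE; apply: (iffP existsP) => -[C].
  by rewrite inE => /and3P[pC /eqP e1 /eqP e2]; exists C.
by case=> pC e1 e2; exists C; rewrite inE pC e1 e2 !eqxx.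
Qed.

Lemma card_swaps : #|M|.+1 = l -> #|M'| = k.+1 ->
  #|swaps l k M M'| = num_pink_chains M M'.
Proof.
(* By [symdiff_swap], [h] recovers the chain from a pair; it is shown to be injective on the swaps
   with the pink chains as image. *)
move=> cM cM'; pose h (Q : matching G l * matching G k) := symdiff M (val Q.1).
have hE Q C : pink_chain M M' C -> val Q.1 = swap M M' C -> h Q = C.
  by case/and3P=> CD _ _ e; rewrite /h e symdiff_swap.
rewrite -(card_in_imset (f := h)); last first.
  move=> Q R /swapsP[A [pA e1 e2]] /swapsP[B [pB e3 e4]].
  rewrite (hE _ _ pA e1) (hE _ _ pB e3) => eAB.
  case: Q R e1 e2 e3 e4 => [Q1 Q2] [R1 R2] /= e1 e2 e3 e4.
  by congr pair; apply: val_inj; rewrite /= ?e1 ?e2 ?e3 ?e4 eAB.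
apply: eq_card => C; rewrite inE; apply/imsetP/idP=> [[Q /swapsP[A [pA e1 e2]] ->]|pC].
  by rewrite (hE _ _ pA e1).
have /and3P[CD _ _] := pC; have cC := pink_chain_card mM mM' pC.
(* The excess of one in [C] raises the size of [M] to [l], and below it lowers that of [M'] to
   [k]. *)
have N1 : is_matching (swap M M' C) && (#|swap M M' C| == l).
  rewrite swap_matching // andTb;
  by rewrite -(eqn_add2r #|M :&: C|) card_swap cC -cM addSnnS.
have N2 : is_matching (swap M' M C) && (#|swap M' M C| == k).
  rewrite swap_matching ?andTb //; last by rewrite symdiffC.
  by rewrite -(eqn_add2r #|M' :&: C|) card_swap cC cM' addSnnS.
pose Q : matching G l * matching G k :=
  (exist _ (swap M M' C) N1, exist _ (swap M' M C) N2).
have eQ : h Q = C by apply: hE.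
by exists Q; rewrite ?eQ //; apply/swapsP; exists C.
Qed.

End Swaps.

(** * Invariance of components, pink chains and swaps under automorphisms *)

Section Equivariance.

Variables (G : sgraph) (s : graph_aut G).
Implicit Types (M C D : {set edge G}).

Lemma aut_edgeK : cancel (aut_edge s) (aut_edge s^-1%g).
Proof.
move=> f; apply: val_inj => /=; rewrite -imset_comp -[RHS]imset_id.
by apply: eq_imset => x /=; rewrite -permM mulgV perm1.
Qed.

Lemma aut_edgeVK : cancel (aut_edge s^-1%g) (aut_edge s).
Proof.
move=> f; apply: val_inj => /=; rewrite -imset_comp -[RHS]imset_id.
by apply: eq_imset => x /=; rewrite -permM mulVg perm1.
Qed.

Lemma aut_edgesK : cancel (fun M => aut_edge s @: M) (fun M => aut_edge s^-1%g @: M).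
Proof.
move=> M; rewrite -imset_comp -[RHS]imset_id.
by apply: eq_imset => f /=; apply: aut_edgeK.
Qed.

Lemma aut_matchingK k : cancel (@aut_matching G k s) (@aut_matching G k s^-1%g).
Proof. by move=> M; apply: val_inj; rewrite /= aut_edgesK. Qed.

Lemma aut_symdiff M M' :
  symdiff (aut_edge s @: M) (aut_edge s @: M') = aut_edge s @: symdiff M M'.
Proof.
have memE := mem_imset _ _ (@aut_edge_inj G s).
by apply/setP=> f; rewrite -[f]aut_edgeVK !(inE, memE).
Qed.

Lemma aut_swap M M' C :
  swap (aut_edge s @: M) (aut_edge s @: M') (aut_edge s @: C)
  = aut_edge s @: swap M M' C.
Proof.
have memE := mem_imset _ _ (@aut_edge_inj G s).
by apply/setP=> f; rewrite -[f]aut_edgeVK !(inE, memE).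
Qed.

Lemma aut_connect D x y :
    connect (sub_adj D) x y ->
  connect (sub_adj (aut_edge s @: D)) (val s x) (val s y).
Proof.
case/connectP=> p; elim: p x => [|z p IH] x /=; first by move=> _ ->.
case/andP=> /sub_adjP[f fD ef] pp /(IH _ pp); apply: connect_trans.
apply/connect1/sub_adjP; exists (aut_edge s f); first exact: imset_f.
by rewrite /= ef imsetU !imset_set1.
Qed.

End Equivariance.

Lemma aut_connectE (G : sgraph) (s : graph_aut G)
    (D : {set edge G}) x y :
  connect (sub_adj (aut_edge s @: D)) (val s x) (val s y)
  = connect (sub_adj D) x y.
Proof.
apply/idP/idP=> [/(aut_connect s^-1%g)|]; last exact: aut_connect.
by rewrite aut_edgesK /= -!permM !mulgV !perm1.
Qed.

Lemma aut_component_edges (G : sgraph) (s : graph_aut G)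
    (D : {set edge G}) x :
  component_edges (aut_edge s @: D) (val s x) = aut_edge s @: component_edges D x.
Proof.
apply/setP=> f; have [fs|fs] := boolP (f \in aut_edge s @: D); last first.
  rewrite inE (negPf fs); apply/esym/negbTE; apply: contra fs.
  by case/imsetP=> g /setIdP[gD _] ->; apply: imset_f.
case/imsetP: (fs) => g gD ef; have [z zg] := edge_inhabited g.
rewrite ef (mem_imset _ _ (@aut_edge_inj _ _)) (mem_component_edges _ gD zg).
have szf : val s z \in val (aut_edge s g) by apply: imset_f.
by rewrite (mem_component_edges _ _ szf) ?aut_connectE -?ef.
Qed.

Lemma aut_components (G : sgraph) (s : graph_aut G)
    (D C : {set edge G}) :
  C \in components D -> aut_edge s @: C \in components (aut_edge s @: D).
Proof.
case/componentsP=> f [x [fD xf ->]]; apply/componentsP.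
exists (aut_edge s f), (val s x); split; first exact: imset_f.
  exact: imset_f.
by rewrite aut_component_edges.
Qed.

Lemma aut_is_matching (G : sgraph) (s : graph_aut G)
    (X : {set edge G}) :
  is_matching X -> is_matching (aut_edge s @: X).
Proof.
move=> mX; have XP : is_matching X && (#|X| == #|X|) by rewrite mX eqxx.
by have /andP[] := aut_matching_subproof s (exist _ X XP : matching G #|X|).
Qed.

(** The counting description [pinkchainE] is transported here, so no vertex path has to be moved
    along [s]. *)
Lemma aut_pink_chain (G : sgraph) (s : graph_aut G)
    (M M' C : {set edge G}) :
    is_matching M -> is_matching M' -> pink_chain M M' C ->
  pink_chain (aut_edge s @: M) (aut_edge s @: M') (aut_edge s @: C).
Proof.
move=> mM mM'; have inj := @aut_edge_inj G s.
rewrite !pink_chainE ?aut_is_matching // aut_symdiff.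
case/andP=> /(aut_components s)-> ltC.
by rewrite -!imsetI ?(card_imset _ inj) //; apply: in2W.
Qed.

Lemma num_pink_chains_aut (G : sgraph) (s : graph_aut G)
    (M M' : {set edge G}) :
    is_matching M -> is_matching M' ->
  num_pink_chains (aut_edge s @: M) (aut_edge s @: M') = num_pink_chains M M'.
Proof.
(* One inequality for every automorphism suffices: applied to [s] and to its inverse, it gives
   equality. *)
have le (t : graph_aut G) X X' : is_matching X -> is_matching X' ->
    (num_pink_chains X X' <= num_pink_chains (aut_edge t @: X) (aut_edge t @: X'))%N.
  move=> mX mX'; rewrite /num_pink_chains.
  rewrite -(card_imset (pink_chains X X') (can_inj (@aut_edgesK G t))).
  apply/subset_leq_card/subsetP=> _ /imsetP[C pC ->].
  by move: pC; rewrite !inE; apply: aut_pink_chain.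
move=> mM mM'; apply/eqP; rewrite eqn_leq le // andbT.
by have := le s^-1%g _ _ (aut_is_matching s mM) (aut_is_matching s mM'); rewrite !aut_edgesK.
Qed.

Definition aut_pair (G : sgraph) a b (s : graph_aut G)
    (Q : matching G a * matching G b) : matching G a * matching G b :=
  (aut_matching s Q.1, aut_matching s Q.2).

Lemma aut_pairK (G : sgraph) a b (s : graph_aut G) :
  cancel (@aut_pair G a b s) (@aut_pair G a b s^-1%g).
Proof. by case=> M M'; rewrite /aut_pair /= !aut_matchingK. Qed.

Lemma mem_aut_swaps (G : sgraph) l k (s : graph_aut G)
    (M M' : {set edge G})
    (Q : matching G l * matching G k) :
    is_matching M -> is_matching M' ->
  (aut_pair s Q \in swaps l k (aut_edge s @: M) (aut_edge s @: M'))
  = (Q \in swaps l k M M').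
Proof.
have sub (t : graph_aut G) X X' (P : matching G l * matching G k) :
    is_matching X -> is_matching X' -> P \in swaps l k X X' ->
    aut_pair t P \in swaps l k (aut_edge t @: X) (aut_edge t @: X').
  move=> mX mX' /swapsP[C [pC e1 e2]]; apply/swapsP; exists (aut_edge t @: C).
  by rewrite aut_pink_chain // /= e1 e2 !aut_swap.
move=> mM mM'; apply/idP/idP; last exact: sub.
move/(sub s^-1%g _ _ _ (aut_is_matching s mM) (aut_is_matching s mM')).
by rewrite aut_pairK !aut_edgesK.
Qed.

(** * The maps on basis vectors, their equivariance and the triangle *)

Section Maps.

Variables (F : fieldType) (G : sgraph).

Lemma actVV_bvec a b s (P : matching G a * matching G b) :
  actVV F a b s (bvec F P) = bvec F (aut_pair s P).
Proof. by rewrite /= linext_bvec /= !linext_bvec tens_bvec. Qed.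

Lemma Pi_bvec a b (P : matching G a * matching G b) :
  Pi F G a b (bvec F P)
  = (\prod_(f in val P.1) xvar F f) * (\prod_(f in val P.2) xvar F f).
Proof. exact: linext_bvec. Qed.

Lemma Phi_bvec l k (P : matching G l.-1 * matching G k.+1) :
  Phi F G l k (bvec F P) = (num_pink_chains (val P.1) (val P.2))%:R^-1 *:
    \sum_(Q in swaps l k (val P.1) (val P.2)) bvec F Q.
Proof.
by rewrite /= linext_bvec; under eq_bigr do rewrite tens_bvec -surjective_pairing.
Qed.

Lemma linear_Phi_bvec (V : lmodType F) l k (h : {linear VV F G l k -> V})
    (P : matching G l.-1 * matching G k.+1) :
  h (Phi F G l k (bvec F P)) = (num_pink_chains (val P.1) (val P.2))%:R^-1 *:
    \sum_(Q in swaps l k (val P.1) (val P.2)) h (bvec F Q).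
Proof.
by apply: (etrans (congr1 h (Phi_bvec P))); rewrite linearZ_LR linear_sum.
Qed.

Lemma act_poly_prod (s : graph_aut G) (X : {set edge G}) :
  act_poly s (\prod_(f in X) xvar F f) = \prod_(f in aut_edge s @: X) xvar F f.
Proof.
rewrite big_imset /=; last by apply: in2W; apply: aut_edge_inj.
rewrite /act_poly rmorph_prod; apply: eq_bigr => f _.
by rewrite /xvar /= comp_mpolyXU -tnth_nth tnth_mktuple enum_rankK.
Qed.

Lemma Pi_equivariant a b (s : graph_aut G) (u : VV F G a b) :
  Pi F G a b (actVV F a b s u) = act_poly s (Pi F G a b u).
Proof.
(* [act_poly s] unfolds to [comp_mpoly t], whose linear and multiplicative structure is used
   below. *)
pose t := [tuple xvar F (aut_edge s (enum_val i)) | i < #|{: edge G}|].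
apply: (eq_linear_bvec (f := Pi F G a b \o actVV F a b s)
  (g := comp_mpoly t \o Pi F G a b)) => P.
change (Pi F G a b (actVV F a b s (bvec F P))
  = comp_mpoly t (Pi F G a b (bvec F P))).
rewrite actVV_bvec; apply: (etrans (Pi_bvec _)).
apply: (etrans _ (esym (congr1 (comp_mpoly t) (Pi_bvec P)))).
by rewrite rmorphM; congr (_ * _); apply/esym; apply: act_poly_prod.
Qed.

Lemma Phi_equivariant l k (s : graph_aut G) (u : VV F G l.-1 k.+1) :
  Phi F G l k (actVV F l.-1 k.+1 s u) = actVV F l k s (Phi F G l k u).
Proof.
apply: (eq_linear_bvec (f := Phi F G l k \o actVV F l.-1 k.+1 s)
  (g := actVV F l k s \o Phi F G l k)) => -[M M'].
have /andP[mM _] := valP M; have /andP[mM' _] := valP M'.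
change (Phi F G l k (actVV F l.-1 k.+1 s (bvec F (M, M')))
  = actVV F l k s (Phi F G l k (bvec F (M, M')))).
rewrite actVV_bvec; apply: (etrans (Phi_bvec _)).
apply: (etrans _ (esym (linear_Phi_bvec _ _))).
rewrite (num_pink_chains_aut s mM mM'); congr (_ *: _).
(* The swaps of the image pair are the images of the swaps, so the sum is reindexed along [s]. *)
rewrite (reindex_inj (can_inj (@aut_pairK G l k s))).
apply: eq_big => Q; first exact: (mem_aut_swaps s Q mM mM').
by move=> _; apply/esym; apply: actVV_bvec.
Qed.

Lemma Pi_Phi l k (u : VV F G l.-1 k.+1) :
    [pchar F] =i pred0 -> (0 < l)%N -> (l <= k)%N ->
  Pi F G l k (Phi F G l k u) = Pi F G l.-1 k.+1 u.
Proof.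
move=> charF l0 lk.
apply: (eq_linear_bvec (f := Pi F G l k \o Phi F G l k)) => -[M M'].
have /andP[mM /eqP cM] := valP M; have /andP[mM' /eqP cM'] := valP M'.
change (Pi F G l k (Phi F G l k (bvec F (M, M')))
  = Pi F G l.-1 k.+1 (bvec F (M, M'))).
apply: (etrans (linear_Phi_bvec _ _)).
(* Every swapped pair has the same monomial as [(M, M')], so the sum becomes constant. *)
transitivity ((num_pink_chains (val M) (val M'))%:R^-1 *:
    \sum_(Q in swaps l k (val M) (val M')) Pi F G l.-1 k.+1 (bvec F (M, M'))).
  congr (_ *: _); apply: eq_bigr => Q /swapsP[C [_ e1 e2]].
  apply: (etrans (Pi_bvec _)); apply: (etrans _ (esym (Pi_bvec _))).
  by rewrite e1 e2 prod_swap.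
(* The number of summands cancels the normalising factor. It is positive because [l.-1 < k.+1],
   hence nonzero in characteristic zero. *)
rewrite sumr_const card_swaps ?cM ?prednK // -scaler_nat scalerA mulVf ?scale1r //.
rewrite (pcharf0P F).1 // -lt0n num_pink_chains_gt0 // cM cM'.
by rewrite (leq_ltn_trans (leq_pred l)).
Qed.

End Maps.

Theorem theorem2p7 (F : fieldType) (charF0 : [pchar F] =i pred0) (G : sgraph)
    (l k : nat) (l_ge1 : (1 <= l)%N) (le_lk : (l <= k)%N)
    (le_kr : (k <= matching_number G)%N) :
  [/\ forall (a b : nat) (s : graph_aut G) (u : VV F G a b),
        Pi F G a b (actVV F a b s u) = act_poly s (Pi F G a b u),
      forall (s : graph_aut G) (u : VV F G l.-1 k.+1),
        Phi F G l k (actVV F l.-1 k.+1 s u) = actVV F l k s (Phi F G l k u)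
    & forall u : VV F G l.-1 k.+1,
        Pi F G l k (Phi F G l k u) = Pi F G l.-1 k.+1 u].
Proof.
split=> [a b s u|s u|u]; first exact: Pi_equivariant.
  exact: Phi_equivariant.
exact: Pi_Phi.
Qed.
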